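(* Let $n$ be a positive integer, let $P=\{(x_i,u_i)\in\mathbf{R}\times\mathbf{R}_F: i=0,1,\dots,n\}$ with $x_0<x_1<\cdots<x_n$, and put $I=[x_0,x_n]$, $I_i=[x_{i-1},x_i]$ for $i=1,\dots,n$. For $i=1,\dots,n$ let $l_i:I\to I_i$ be a contractive homeomorphism with $l_i(x_0)=x_{i-1}$ and $l_i(x_n)=x_i$, let $s_i$ be a constant with $0\le s_i<1$, and let $q_i:I_i\to\mathbf{R}_F$ be a Lipschitz mapping (with respect to $d_\infty$ on $\mathbf{R}_F$) such that the mapping $F_i:I\times\mathbf{R}_F\to\mathbf{R}_F$, $F_i(x,u)=s_iu\oplus q_i(l_i(x))$, satisfies $F_i(x_0,u_0)=u_{i-1}$ and $F_i(x_n,u_n)=u_i$. Let $f:I\to\mathbf{R}_F$ be the fuzzy-valued fractal interpolation function interpolating $P$ determined by these data. Then for each $\lambda\in[0,1]$, the functions $x\mapsto (f(x))^-(\lambda)$ and $x\mapsto (f(x))^+(\lambda)$ on $I$ are the fractal interpolation functions $g_\lambda^-$ and $g_\lambda^+$ interpolating $P_\lambda^-=\{(x_i,u_i^-(\lambda)):i=0,\dots,n\}$ and $P_\lambda^+=\{(x_i,u_i^+(\lambda)):i=0,\dots,n\}$, respectively; here $g_\lambda^\pm$ is the fractal interpolation function generated by the iterated function system $\{(l_i,(F_i)_\lambda^\pm):i=1,\dots,n\}$ on $I\times\mathbf{R}$, where $(F_i)_\lambda^\pm(x,y)=s_iy+(q_i(l_i(x)))^\pm(\lambda)$ for $(x,y)\in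 I\times\mathbf{R}$.
   Context: A fuzzy number is a function $u:\mathbf{R}\to[0,1]$ that is normal ($u(y)=1$ for some $y$), upper semicontinuous, convex ($u(ty+(1-t)z)\ge\min\{u(y),u(z)\}$ for all $y,z\in\mathbf{R}$, $t\in[0,1]$) and compactly supported (the closure of $\{y:u(y)>0\}$ is compact). $\mathbf{R}_F$ is the set of fuzzy numbers. For $u\in\mathbf{R}_F$, the $\lambda$-level set is $[u]^\lambda=\{y:u(y)\ge\lambda\}$ for $\lambda\in(0,1]$ and $[u]^0=\overline{\{y:u(y)>0\}}$; it is a closed interval, written $[u^-(\lambda),u^+(\lambda)]$. The operations are defined by level sets: $[u\oplus v]^\lambda=[u]^\lambda+[v]^\lambda$ and $[cu]^\lambda=c[u]^\lambda$ for $c\in\mathbf{R}$ (Minkowski sum and scaling of intervals). The metric on $\mathbf{R}_F$ is $d_\infty(u,v)=\sup_{\lambda\in[0,1]}\max\{|u^-(\lambda)-v^-(\lambda)|,|u^+(\lambda)-v^+(\lambda)|\}$; $(\mathbf{R}_F,d_\infty)$ is a complete metric space. A mapping between metric spaces is contractive if it is Lipschitz with some constant in $[0,1)$. The fuzzy-valued fractal interpolation function $f$ interpolating $P$ is the continuous function $f:I\to(\mathbf{R}_F,d_\infty)$ with $f(x_i)=u_i$ $(i=0,\dots,n)$ whose graph is the attractor (unique nonempty compact set $B$ with $B=\bigcup_{i=1}^n w_i(B)$) of the iterated function system $w_i(x,u)=(l_i(x),F_i(x,u))$ on $I\times\mathbf{R}_F$; equivalently, it is the unique continuous function with $f(x_i)=u_i$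 for all $i$ and $f(x)=s_if(l_i^{-1}(x))\oplus q_i(x)$ for $x\in I_i$, $i=1,\dots,n$. Likewise, the fractal interpolation function $g_\lambda^\pm:I\to\mathbf{R}$ is the continuous function interpolating $P_\lambda^\pm$ whose graph is the attractor of the iterated function system $(x,y)\mapsto(l_i(x),(F_i)_\lambda^\pm(x,y))$ on $I\times\mathbf{R}$; equivalently, it is the unique continuous function with $g_\lambda^\pm(x_i)=u_i^\pm(\lambda)$ for all $i$ and $g_\lambda^\pm(x)=s_ig_\lambda^\pm(l_i^{-1}(x))+(q_i(x))^\pm(\lambda)$ for $x\in I_i$, $i=1,\dots,n$. *)

(* Defs.v *)
From HB Require Import structures.
From mathcomp Require Import all_boot all_order all_algebra.
From mathcomp Require Import all_classical all_reals all_analysis.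
From mathcomp Require Import ring lra.

Set Implicit Arguments.
Unset Strict Implicit.
Unset Printing Implicit Defensive.

Import Order.TTheory GRing.Theory Num.Theory.
Import numFieldNormedType.Exports.

Local Open Scope classical_set_scope.
Local Open Scope ring_scope.

Record fuzzy (R : realType) := Fuzzy {
  grade :> R -> R ;
  grade01 : forall y, 0 <= grade y <= 1 ;
  grade_normal : exists y, grade y = 1 ;
  grade_usc : forall y c, grade y < c -> \forall z \near y, grade z < c ;
  grade_convex : forall y z t, 0 <= t <= 1 ->
    Num.min (grade y) (grade z) <= grade (t * y + (1 - t) * z) ;
  grade_compact : compact (closure [set y | 0 < grade y])
}.

HB.instance Definition _ (R : realType) := gen_eqMixin (fuzzy R).
HB.instance Definition _ (R : realType) := gen_choiceMixin (fuzzy R).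

(* Only meaningful for [lambda] in [0, 1]. *)
Definition level (R : realType) (u : fuzzy R) (lambda : R) : set R :=
  if lambda == 0 then closure [set y | 0 < u y] else [set y | lambda <= u y].

(* The endpoints u^-(lambda) and u^+(lambda); see [level_itv]. *)
Definition level_lo (R : realType) (u : fuzzy R) (lambda : R) : R :=
  inf (level u lambda).

Definition level_hi (R : realType) (u : fuzzy R) (lambda : R) : R :=
  sup (level u lambda).

Definition minkowski_sum (R : realType) (A B : set R) : set R :=
  [set a + b | a in A & b in B].

Definition minkowski_scale (R : realType) (c : R) (A : set R) : set R :=
  [set c * a | a in A].

Section level_sets.
Context {R : realType}.
Implicit Types (u v w : fuzzy R) (lambda mu c y z : R).

Lemma levelE u lambda : 0 < lambda -> level u lambda = [set y | lambda <= u y].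
Proof. by rewrite /level lt0r => /andP[/negbTE ->]. Qed.

Lemma level0 u : level u 0 = closure [set y | 0 < u y].
Proof. by rewrite /level eqxx. Qed.

Lemma level_anti u mu lambda : 0 <= mu -> mu <= lambda ->
  level u lambda `<=` level u mu.
Proof.
rewrite le_eqVlt => /predU1P[<-|mu0] ml; last first.
  rewrite !levelE//; last exact: lt_le_trans ml.
  by move=> y /=; apply: le_trans.
move: ml; rewrite le_eqVlt => /predU1P[<-//|l0].
rewrite level0 levelE// => y /= ly; apply: subset_closure => /=.
exact: lt_le_trans ly.
Qed.

Lemma level_closed u lambda : 0 <= lambda -> closed (level u lambda).
Proof.
rewrite le_eqVlt => /predU1P[<-|l0]; first by rewrite level0; exact: closed_closure.
rewrite levelE// -[X in closed X]setCK; apply: open_closedC.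
rewrite openE => y /= /negP; rewrite -ltNge => /grade_usc.
by apply: filterS => z; rewrite ltNge => /negP.
Qed.

Lemma level_nonempty u lambda : 0 <= lambda <= 1 -> level u lambda !=set0.
Proof.
move=> /andP[l0 l1]; have [y uy] := grade_normal u; exists y.
by apply: (level_anti l0 l1); rewrite levelE//= uy.
Qed.

Lemma level_interval u lambda : 0 <= lambda -> is_interval (level u lambda).
Proof.
have posi mu : 0 < mu -> is_interval (level u mu).
  move=> mu0; rewrite levelE// => a b /= ua ub z /andP[az zb].
  have [ab|ab] := eqVneq a b.
    by suff -> : z = a by []; apply/eqP; rewrite eq_le az ab zb.
  have lab : 0 < b - a by rewrite subr_gt0 lt_neqAle ab (le_trans az).
  have ht : 0 <= (b - z) / (b - a) <= 1.
    rewrite divr_ge0 ?subr_ge0 ?(le_trans az)//=.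
    by rewrite ler_pdivrMr// mul1r lerB.
  have := grade_convex u a b ht.
  have -> : (b - z) / (b - a) * a + (1 - (b - z) / (b - a)) * b = z.
    by field; rewrite gt_eqF.
  by apply: le_trans; rewrite le_min ua.
rewrite le_eqVlt => /predU1P[<-|]; last exact: posi.
rewrite level0; apply/connected_intervalP; apply: connected_closure.
apply/connected_intervalP => a b /= ua ub z azb.
have m0 : 0 < Num.min (u a) (u b) by rewrite lt_min ua.
have := @posi _ m0 a b; rewrite levelE//= !ge_min !lexx orbT => /(_ isT isT _ azb).
exact: lt_le_trans.
Qed.

Lemma level_bounded u : exists M, forall lambda, 0 <= lambda -> forall y,
  level u lambda y -> `|y| <= M.
Proof.
have /compact_bounded[M [_ /(_ (M + 1))]] := @grade_compact _ u.
rewrite ltrDl => /(_ ltr01) HM; exists (M + 1) => lambda l0 y ly.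
by apply: HM; rewrite -level0; apply: level_anti ly.
Qed.

Lemma level_has_lbound u lambda : 0 <= lambda -> has_lbound (level u lambda).
Proof.
have [M HM] := level_bounded u; move=> l0; exists (- M) => y /(HM _ l0).
by rewrite ler_norml => /andP[].
Qed.

Lemma level_has_ubound u lambda : 0 <= lambda -> has_ubound (level u lambda).
Proof.
have [M HM] := level_bounded u; move=> l0; exists M => y /(HM _ l0).
by rewrite ler_norml => /andP[].
Qed.

Lemma level_lo_mem u lambda : 0 <= lambda <= 1 -> level u lambda (level_lo u lambda).
Proof.
move=> l01; have /andP[l0 _] := l01.
apply: (level_closed l0) => V /nbhs_ballP[e /= e0 Ve].
have hi : has_inf (level u lambda).
  by split; [exact: level_nonempty|exact: level_has_lbound].
have [y ly yl] := inf_adherent e0 hi; exists y; split=> //; apply: Ve.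
rewrite /ball/= distrC ger0_norm; first by rewrite ltrBlDl.
by rewrite subr_ge0; apply: ge_inf ly; case: hi.
Qed.

Lemma level_hi_mem u lambda : 0 <= lambda <= 1 -> level u lambda (level_hi u lambda).
Proof.
move=> l01; have /andP[l0 _] := l01.
apply: (level_closed l0); apply: closure_sup; first exact: level_nonempty.
exact: level_has_ubound.
Qed.

Lemma level_itv u lambda : 0 <= lambda <= 1 ->
  level u lambda = `[level_lo u lambda, level_hi u lambda]%classic.
Proof.
move=> l01; have /andP[l0 _] := l01; apply/seteqP; split=> y /=.
  move=> ly; rewrite in_itv/=; apply/andP; split.
    by apply: ge_inf => //; exact: level_has_lbound.
  by apply: ub_le_sup => //; exact: level_has_ubound.
rewrite in_itv/= => lyh; apply: level_interval lyh => //.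
- exact: level_lo_mem.
- exact: level_hi_mem.
Qed.

Lemma level_memP u lambda y : 0 <= lambda <= 1 ->
  level u lambda y <-> level_lo u lambda <= y <= level_hi u lambda.
Proof. by move=> l01; rewrite level_itv//= in_itv. Qed.

Lemma level_lohi u lambda : 0 <= lambda <= 1 -> level_lo u lambda <= level_hi u lambda.
Proof. by move=> l01; have /(level_memP _ _ l01)/andP[] := level_lo_mem u l01. Qed.

(* The conditions satisfied by u^- and by - u^+, which characterize such     *)
(* endpoint functions.                                                       *)
Definition lower_cut (a : R -> R) := [/\
  forall mu lambda, 0 <= mu -> mu <= lambda -> lambda <= 1 -> a mu <= a lambda,
  forall lambda c, 0 < lambda <= 1 ->
    (forall mu, 0 < mu < lambda -> a mu <= c) -> a lambda <= c &
  forall c, (forall mu, 0 < mu <= 1 -> c <= a mu) -> c <= a 0].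

Lemma le_grade u lambda y : (forall mu, 0 < mu < lambda -> mu <= u y) -> lambda <= u y.
Proof.
move=> H; rewrite leNgt; apply/negP => uyl.
have /andP[uy0 _] := @grade01 _ u y.
have := H ((u y + lambda) / 2); lra.
Qed.

Lemma lower_cut_lo u : lower_cut (level_lo u).
Proof.
split=> [mu lambda m0 ml l1|lambda c /andP[l0 l1] H|c H].
- have l01 : 0 <= lambda <= 1 by rewrite (le_trans m0 ml).
  have /(level_anti m0 ml) := level_lo_mem u l01.
  by move=> /level_memP; rewrite m0 (le_trans ml)// => /(_ isT)/andP[].
- have l01 : 0 <= lambda <= 1 by rewrite ltW.
  rewrite leNgt; apply/negP => cl.
  suff : level u lambda c by move=> /(level_memP _ _ l01)/andP[]; rewrite leNgt cl.
  rewrite levelE//=; apply: le_grade => mu m0l; have /andP[m0 ml] := m0l.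
  have m01 : 0 <= mu <= 1 by rewrite ltW// (le_trans (ltW ml)).
  suff : level u mu c by rewrite levelE.
  apply/level_memP => //; rewrite H//=.
  rewrite (le_trans (ltW cl))//.
  have /(level_anti (ltW m0) (ltW ml)) := level_lo_mem u l01.
  by move=> /(level_memP _ _ m01)/andP[].
- have h0 : 0 <= (0 : R) <= 1 by rewrite lexx ler01.
  have := level_lo_mem u h0; rewrite level0 => lc.
  have : closure [set y | 0 < u y] `<=` [set y | c <= y].
    have -> : [set y | c <= y] = closure [set y | c <= y].
      by apply: (closure_id _).1; exact: closed_ge.
    apply: closureS => y /= uy0; have /andP[_ uy1] := @grade01 _ u y.
    apply: le_trans (H (u y) _) _; first by rewrite uy0.
    have : level u (u y) y by rewrite levelE//=.
    by move=> /level_memP; rewrite (ltW uy0) uy1 => /(_ isT)/andP[].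
  exact.
Qed.

Lemma lower_cut_hi u : lower_cut (fun lambda => - level_hi u lambda).
Proof.
split=> [mu lambda m0 ml l1|lambda c /andP[l0 l1] H|c H].
- have l01 : 0 <= lambda <= 1 by rewrite (le_trans m0 ml).
  have /(level_anti m0 ml) := level_hi_mem u l01.
  by move=> /level_memP; rewrite m0 (le_trans ml)// lerN2 => /(_ isT)/andP[].
- have l01 : 0 <= lambda <= 1 by rewrite ltW.
  rewrite lerNl leNgt; apply/negP => cl.
  suff : level u lambda (- c).
    by move=> /(level_memP _ _ l01)/andP[_]; rewrite leNgt cl.
  rewrite levelE//=; apply: le_grade => mu m0l; have /andP[m0 ml] := m0l.
  have m01 : 0 <= mu <= 1 by rewrite ltW// (le_trans (ltW ml)).
  suff : level u mu (- c) by rewrite levelE.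
  apply/level_memP => //; apply/andP; split; last by rewrite lerNl H.
  rewrite (le_trans _ (ltW cl))//.
  have /(level_anti (ltW m0) (ltW ml)) := level_hi_mem u l01.
  by move=> /(level_memP _ _ m01)/andP[].
- have h0 : 0 <= (0 : R) <= 1 by rewrite lexx ler01.
  have := level_hi_mem u h0; rewrite level0 => lc.
  have : closure [set y | 0 < u y] `<=` [set y | y <= - c].
    have -> : [set y | y <= - c] = closure [set y | y <= - c].
      by apply: (closure_id _).1; exact: closed_le.
    apply: closureS => y /= uy0; have /andP[_ uy1] := @grade01 _ u y.
    rewrite lerNr; apply: le_trans (H (u y) _) _; first by rewrite uy0.
    have : level u (u y) y by rewrite levelE//=.
    by move=> /level_memP; rewrite (ltW uy0) uy1 lerN2 => /(_ isT)/andP[].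
  by move=> /(_ _ lc)/=; rewrite lerNr.
Qed.

Lemma lower_cutD (a b : R -> R) : lower_cut a -> lower_cut b ->
  lower_cut (fun lambda => a lambda + b lambda).
Proof.
move=> [am al a0] [bm bl b0]; split=> [mu lambda m0 ml l1|lambda c l01 H|c H].
- by rewrite lerD ?am ?bm.
- have /andP[l0 l1] := l01; rewrite -lerBrDr; apply: al => // mu /andP[m0 ml].
  rewrite lerBrDr -lerBrDl; apply: bl => // nu /andP[n0 nl]; rewrite lerBrDl.
  have M0 : 0 < Num.max mu nu < lambda by rewrite lt_max m0 gt_max ml.
  have /andP[_ /ltW Ml] := M0.
  apply: le_trans (H _ M0); apply: lerD.
    by apply: am; rewrite ?(ltW m0) ?le_max ?lexx// (le_trans Ml).
  by apply: bm; rewrite ?(ltW n0) ?le_max ?lexx ?orbT// (le_trans Ml).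
- rewrite -lerBlDr; apply: a0 => mu /andP[m0 m1].
  rewrite lerBlDr -lerBlDl; apply: b0 => nu /andP[n0 n1]; rewrite lerBlDl.
  have M0 : 0 < Num.min mu nu <= 1 by rewrite lt_min m0 n0 ge_min m1.
  have /andP[/ltW M00 _] := M0.
  apply: le_trans (H _ M0) _; apply: lerD.
    by apply: am; rewrite ?ge_min ?lexx.
  by apply: bm; rewrite ?ge_min ?lexx ?orbT.
Qed.

Lemma lower_cutZ c (a : R -> R) : 0 <= c -> lower_cut a ->
  lower_cut (fun lambda => c * a lambda).
Proof.
rewrite le_eqVlt => /predU1P[<- _|c0 [am al a0]].
  split=> [*|lambda c' /andP[l0 l1] /(_ (lambda / 2))|c' /(_ 1)].
  - by rewrite !mul0r.
  - by rewrite !mul0r; apply; lra.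
  - by rewrite !mul0r; apply; rewrite ltr01 lexx.
split=> [mu lambda m0 ml l1|lambda c' l01 H|c' H].
- by rewrite ler_pM2l// am.
- rewrite -ler_pdivlMl//; apply: al => // mu /H.
  by rewrite -ler_pdivlMl.
- by rewrite -ler_pdivrMl//; apply: a0 => mu /H; rewrite -ler_pdivrMl.
Qed.

Lemma fuzzy_of_cuts (a b : R -> R) :
  (forall lambda, 0 <= lambda <= 1 -> a lambda <= b lambda) ->
  lower_cut a -> lower_cut (fun lambda => - b lambda) ->
  exists w, forall lambda, 0 <= lambda <= 1 ->
    level w lambda = `[a lambda, b lambda]%classic.
Proof.
move=> ab [am al a0] [bm bl b0].
have bm' mu lambda : 0 <= mu -> mu <= lambda -> lambda <= 1 -> b lambda <= b mu.
  by move=> *; rewrite -lerN2 bm.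
have bl' lambda c : 0 < lambda <= 1 ->
    (forall mu, 0 < mu < lambda -> c <= b mu) -> c <= b lambda.
  by move=> l01 H; rewrite -lerN2; apply: bl => // mu /H; rewrite lerN2.
have b0' c : (forall mu, 0 < mu <= 1 -> b mu <= c) -> b 0 <= c.
  by move=> H; rewrite -lerN2; apply: b0 => // mu /H; rewrite lerN2.
have i00 : 0 <= (0 : R) <= 1 by rewrite lexx ler01.
have i01 : 0 <= (1 : R) <= 1 by rewrite lexx ler01.
pose A z := [set lambda | lambda = 0 \/ 0 <= lambda <= 1 /\ a lambda <= z <= b lambda].
pose w z := sup (A z).
have Aub z : ubound (A z) 1 by move=> ? [->//|[/andP[]]].
have As z : has_sup (A z) by split; [exists 0; left|exists 1].
have w0 z : 0 <= w z by apply: ub_le_sup; [exists 1|left].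
have w1 z : w z <= 1 by apply: ge_sup => //; exists 0; left.
have wE lambda z : 0 < lambda <= 1 -> (lambda <= w z) = (a lambda <= z <= b lambda).
  move=> l01; have /andP[l0 l1] := l01; apply/idP/idP => [lw|abz].
    have H mu : 0 < mu < lambda -> a mu <= z <= b mu.
      move=> /andP[m0 ml]; have : 0 < w z - mu by rewrite subr_gt0 (lt_le_trans ml).
      move=> /(sup_adherent)/(_ (As z))[nu Anu]; rewrite opprB addrC subrK => mn.
      have n0 := lt_trans m0 mn.
      case: Anu => [nu0|[/andP[_ n1] /andP[az zb]]].
        by move: n0; rewrite nu0 ltxx.
      by rewrite (le_trans (am _ _ _ _ _) az) ?(ltW m0) ?(ltW mn)//=
         (le_trans zb)// bm' ?(ltW m0) ?(ltW mn).
    by rewrite al ?bl'// => mu /H/andP[].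
  by apply: ub_le_sup; [exists 1|right; rewrite (ltW l0)].
have wI lambda z z' y : 0 < lambda <= 1 -> lambda <= w z -> lambda <= w z' ->
    z <= y <= z' -> lambda <= w y.
  move=> l01; rewrite !wE// => /andP[az zb] /andP[az' zb'] /andP[zy yz'].
  by rewrite (le_trans az)//= (le_trans yz').
have wsupp : closure [set y | 0 < w y] = `[a 0, b 0]%classic.
  apply/seteqP; split.
    have -> : `[a 0, b 0]%classic = closure `[a 0, b 0]%classic.
      by apply: (closure_id _).1; exact: interval_closed.
    apply: closureS => y /= wy; have w01 : 0 < w y <= 1 by rewrite wy w1.
    have : w y <= w y by []; rewrite wE// in_itv/= => /andP[ay yb].
    by rewrite (le_trans (am _ _ _ _ _) ay) ?(ltW wy)//= (le_trans yb)// bm' ?(ltW wy).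
  move=> z /=; rewrite in_itv/= => /andP[az zb].
  move=> V /nbhs_ballP[e /= e0 Ve].
  have [za1|a1z] := ltP z (a 1).
    have [mu m01 am_z] : exists2 mu, 0 < mu <= 1 & a mu < z + e.
      apply: contrapT => H; have : z + e <= a 0.
        apply: a0 => mu m01; rewrite leNgt; apply/negP => ?; apply: H.
        by exists mu.
      by have := e0; lra.
    have /andP[m0 m1] := m01; have m01' : 0 <= mu <= 1 by rewrite ltW.
    exists (Num.max z (a mu)); split.
      rewrite /= (lt_le_trans m0)// wE// le_max lexx orbT ge_max (ab _ m01') andbT.
      by rewrite (le_trans (ltW za1))// (le_trans (ab _ i01))// bm' ?(ltW m0).
    apply: Ve; rewrite /ball/= distrC ger0_norm ?subr_ge0 ?le_max ?lexx//.
    by rewrite ltrBlDl gt_max am_z andbT ltrDl.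
  have [b1z|zb1] := ltP (b 1) z.
    have [mu m01 bm_z] : exists2 mu, 0 < mu <= 1 & z - e < b mu.
      apply: contrapT => H; have : b 0 <= z - e.
        apply: b0' => mu m01; rewrite leNgt; apply/negP => ?; apply: H.
        by exists mu.
      by have := e0; lra.
    have /andP[m0 m1] := m01; have m01' : 0 <= mu <= 1 by rewrite ltW.
    exists (Num.min z (b mu)); split.
      rewrite /= (lt_le_trans m0)// wE// ge_min lexx orbT andbT le_min (ab _ m01') andbT.
      by rewrite (le_trans _ (ltW b1z))// (le_trans _ (ab _ i01))// am ?(ltW m0).
    apply: Ve; rewrite /ball/= ger0_norm ?subr_ge0 ?ge_min ?lexx//.
    by rewrite ltrBlDr addrC -ltrBlDr lt_min bm_z andbT ltrBlDr ltrDl.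
  exists z; split; last by apply: Ve; exact: ballxx.
  by rewrite /= (lt_le_trans ltr01)// wE ?ltr01 ?lexx// a1z.
unshelve eexists (@Fuzzy R w _ _ _ _ _).
- by move=> y; rewrite w0 w1.
- exists (a 1); apply/eqP; rewrite eq_le w1 wE ?ltr01 ?lexx//=.
  by rewrite ab.
- move=> y c wc; have [c1|c1] := ltP 1 c.
    by exists 1 => //= z _; exact: le_lt_trans c1.
  have c01 : 0 < c <= 1 by rewrite (le_lt_trans (w0 y)).
  have : ~ `[a c, b c]%classic y by rewrite /= in_itv/= -wE// leNgt wc.
  have /closed_openC := @interval_closed R (BLeft (a c)) (BRight (b c)) isT isT.
  rewrite openE => /[apply]; apply: filterS => z /=.
  by rewrite in_itv/= -wE// ltNge => /negP.
- move=> y z t /andP[t0 t1]; set m := Num.min _ _.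
  have [m0|m0] := leP m 0; first exact: le_trans (w0 _).
  have m01 : 0 < m <= 1 by rewrite m0 ge_min w1.
  have my : m <= w y by rewrite ge_min lexx.
  have mz : m <= w z by rewrite ge_min lexx orbT.
  by have [yz|/ltW zy] := leP y z; [apply: (wI m y z)|apply: (wI m z y)] => //;
    apply/andP; split; nra.
- by rewrite wsupp; exact: segment_compact.
- move=> lambda /andP[l0 l1] /=; rewrite /level/=.
  case: eqP => [->//|/eqP ln0].
  have l01 : 0 < lambda <= 1 by rewrite lt0r ln0 l0.
  by apply/seteqP; split => z /=; rewrite in_itv/= wE.
Qed.

Lemma minkowski_sum_itv (a b c d : R) : a <= b -> c <= d ->
  minkowski_sum `[a, b] `[c, d] = `[a + c, b + d]%classic.
Proof.
move=> ab cd; apply/seteqP; split=> [_ [y + [z + <-]]|z] /=; rewrite !in_itv/=.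
  by move=> /andP[? ?] /andP[? ?]; rewrite !lerD.
move=> /andP[az zb]; have [h|h] := leP a (z - d).
  by exists (z - d); [|exists d; [|lra]]; rewrite /= in_itv/=; apply/andP; split; lra.
by exists a; [|exists (z - a); [|lra]]; rewrite /= in_itv/=; apply/andP; split; lra.
Qed.

Lemma minkowski_scale_itv_ge0 (c a b : R) : 0 <= c -> a <= b ->
  minkowski_scale c `[a, b] = `[c * a, c * b]%classic.
Proof.
move=> c0 ab; apply/seteqP; split=> [_ [y + <-]|z] /=; rewrite !in_itv/=.
  by move=> /andP[? ?]; rewrite !ler_wpM2l.
move: c0; rewrite (le_eqVlt 0) => /predU1P[<-|c0].
  rewrite !mul0r => z0; exists a; first by rewrite /= in_itv/= lexx.
  by rewrite mul0r; lra.
move=> /andP[az zb]; exists (c^-1 * z); last by rewrite mulrA divff ?mul1r ?gt_eqF.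
by rewrite /= in_itv/= ler_pdivlMl// az ler_pdivrMl.
Qed.

Lemma minkowski_scale_itv_le0 (c a b : R) : c <= 0 -> a <= b ->
  minkowski_scale c `[a, b] = `[c * b, c * a]%classic.
Proof.
move=> c0 ab; have cN0 : 0 <= - c by rewrite oppr_ge0.
have := @minkowski_scale_itv_ge0 (- c) (- b) (- a) cN0; rewrite lerN2 => /(_ ab).
rewrite !mulrNN => <-; apply/seteqP; split=> _ [y yI <-].
  have /andP[? ?] : a <= y <= b := yI.
  by exists (- y); [rewrite /= in_itv/=; apply/andP; split; lra|rewrite mulrNN].
have /andP[? ?] : - b <= y <= - a := yI.
by exists (- y); [rewrite /= in_itv/=; apply/andP; split; lra|rewrite mulrN mulNr].
Qed.

Lemma fuzzy_add_subproof u v : exists w, forall lambda, 0 <= lambda <= 1 ->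
  level w lambda = minkowski_sum (level u lambda) (level v lambda).
Proof.
have [|||w Hw] := @fuzzy_of_cuts (fun l => level_lo u l + level_lo v l)
   (fun l => level_hi u l + level_hi v l).
- by move=> l l01; rewrite lerD ?level_lohi.
- exact: lower_cutD (lower_cut_lo u) (lower_cut_lo v).
- have := lower_cutD (lower_cut_hi u) (lower_cut_hi v).
  by under eq_fun do rewrite -opprD.
- exists w => l l01; rewrite Hw// !level_itv// minkowski_sum_itv//;
  exact: level_lohi.
Qed.

Lemma fuzzy_scale_subproof c u : exists w, forall lambda, 0 <= lambda <= 1 ->
  level w lambda = minkowski_scale c (level u lambda).
Proof.
have [c0|/ltW c0] := leP 0 c.
  have [|||w Hw] := @fuzzy_of_cuts (fun l => c * level_lo u l)
     (fun l => c * level_hi u l).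
  - by move=> l l01; rewrite ler_wpM2l ?level_lohi.
  - exact: lower_cutZ (lower_cut_lo u).
  - have := lower_cutZ c0 (lower_cut_hi u).
    by under eq_fun do rewrite mulrN.
  - by exists w => l l01; rewrite Hw// !level_itv// minkowski_scale_itv_ge0 ?level_lohi.
have cN0 : 0 <= - c by rewrite oppr_ge0.
have [|||w Hw] := @fuzzy_of_cuts (fun l => c * level_hi u l)
   (fun l => c * level_lo u l).
- by move=> l l01; rewrite ler_wnM2l ?level_lohi.
- have := lower_cutZ cN0 (lower_cut_hi u).
  by under eq_fun do rewrite mulrNN.
- have := lower_cutZ cN0 (lower_cut_lo u).
  by under eq_fun do rewrite mulNr.
- by exists w => l l01; rewrite Hw// !level_itv// minkowski_scale_itv_le0 ?level_lohi.
Qed.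

End level_sets.

Definition fuzzy_add (R : realType) (u v : fuzzy R) : fuzzy R :=
  sval (cid (fuzzy_add_subproof u v)).

Definition fuzzy_scale (R : realType) (c : R) (u : fuzzy R) : fuzzy R :=
  sval (cid (fuzzy_scale_subproof c u)).

Lemma level_fuzzy_add (R : realType) (u v : fuzzy R) (lambda : R) :
  0 <= lambda <= 1 -> level (fuzzy_add u v) lambda =
    minkowski_sum (level u lambda) (level v lambda).
Proof. exact: (svalP (cid (fuzzy_add_subproof u v))). Qed.

Lemma level_fuzzy_scale (R : realType) (c : R) (u : fuzzy R) (lambda : R) :
  0 <= lambda <= 1 -> level (fuzzy_scale c u) lambda =
    minkowski_scale c (level u lambda).
Proof. exact: (svalP (cid (fuzzy_scale_subproof c u))). Qed.

(* Hence [level_fuzzy_add] and [level_fuzzy_scale] determine the operations. *)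
Lemma level_inj (R : realType) (u v : fuzzy R) :
  (forall lambda, 0 <= lambda <= 1 -> level u lambda = level v lambda) -> u = v.
Proof.
move=> uv.
have sub (u' v' : fuzzy R) y : (forall lambda, 0 <= lambda <= 1 ->
    level u' lambda = level v' lambda) -> u' y <= v' y.
  move=> H; have := @grade01 _ u' y; rewrite le_eqVlt => /andP[/predU1P[<- _|u0 u1]].
    by have /andP[] := @grade01 _ v' y.
  have : level u' (u' y) y by rewrite levelE/=.
  by rewrite H ?levelE//= (ltW u0).
have : grade u = grade v.
  apply/funext => y; apply/eqP; rewrite eq_le !sub// => l /uv //.
case: u v {uv} => [g g1 g2 g3 g4 g5] [h h1 h2 h3 h4 h5] /= gh.
by subst h; congr Fuzzy; exact: Prop_irrelevance.
Qed.

Definition endpoint_gap (R : realType) (u v : fuzzy R) (lambda : R) : R :=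
  Num.max `|level_lo u lambda - level_lo v lambda|
          `|level_hi u lambda - level_hi v lambda|.

Definition fuzzy_dist (R : realType) (u v : fuzzy R) : R :=
  sup [set endpoint_gap u v lambda | lambda in `[0, 1]].

Section fuzzy_metric.
Context {R : realType}.
Implicit Types u v w : fuzzy R.

Lemma gap_has_ubound u v : has_ubound (endpoint_gap u v @` `[0, 1]).
Proof.
have [M HM] := level_bounded u; have [N HN] := level_bounded v.
exists (M + N) => _ [l + <-]; rewrite /= in_itv/= => l01; have /andP[l0 _] := l01.
by rewrite /endpoint_gap ge_max; apply/andP; split; rewrite (le_trans (ler_normB _ _))// lerD//;
  (apply: (HM l) || apply: (HN l)) => //; (apply: level_lo_mem || apply: level_hi_mem).
Qed.

Lemma gap_le_dist u v lambda : 0 <= lambda <= 1 -> endpoint_gap u v lambda <= fuzzy_dist u v.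
Proof.
move=> l01; apply: ub_le_sup; first exact: gap_has_ubound.
by exists lambda.
Qed.

Lemma dist_le_gap u v c : (forall lambda, 0 <= lambda <= 1 -> endpoint_gap u v lambda <= c) ->
  fuzzy_dist u v <= c.
Proof.
move=> H; apply: ge_sup; last by move=> _ [l + <-]; rewrite /= in_itv/=; exact: H.
by exists (endpoint_gap u v 0), 0 => //=; rewrite in_itv/= lexx ler01.
Qed.

Let distxx u : fuzzy_dist u u = 0.
Proof.
apply/eqP; rewrite eq_le; apply/andP; split.
  by apply: dist_le_gap => l _; rewrite /endpoint_gap !subrr normr0 maxxx.
have h0 : 0 <= (0 : R) <= 1 by rewrite lexx ler01.
by apply: le_trans (gap_le_dist u u h0); rewrite le_max normr_ge0.
Qed.

Let dist_positivity u v : fuzzy_dist u v = 0 -> u = v.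
Proof.
move=> uv0; apply: level_inj => l l01; rewrite !level_itv//.
have := gap_le_dist u v l01; rewrite uv0 /endpoint_gap ge_max !normr_le0 !subr_eq0.
by move=> /andP[/eqP -> /eqP ->].
Qed.

Let dist_sym u v : fuzzy_dist u v = fuzzy_dist v u.
Proof.
rewrite /fuzzy_dist; congr sup; apply: eq_imagel => l _.
by rewrite /endpoint_gap distrC; congr Num.max; rewrite distrC.
Qed.

Let dist_triangle v u w : fuzzy_dist u w <= fuzzy_dist u v + fuzzy_dist v w.
Proof.
apply: dist_le_gap => l l01.
apply: le_trans (lerD (gap_le_dist u v l01) (gap_le_dist v w l01)).
rewrite /endpoint_gap ge_max; apply/andP; split.
- apply: le_trans (ler_distD (level_lo v l) _ _) _.
  by apply: lerD; rewrite le_max lexx.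
- apply: le_trans (ler_distD (level_hi v l) _ _) _.
  by apply: lerD; rewrite le_max lexx orbT.
Qed.

HB.instance Definition _ := @isMetric.Build R (fuzzy R) (@fuzzy_dist R)
  distxx dist_positivity dist_sym dist_triangle.

End fuzzy_metric.

(* The library makes only [R^o] a metric space, with distance |y - x|. *)
HB.instance Definition _ (R : realType) := Metric.copy R R^o.

Definition lipschitz_in (R : realType) (M N : metricType R) (k : R) (A : set M)
    (f : M -> N) :=
  forall a b, A a -> A b -> mdist (f a) (f b) <= k * mdist a b.

Definition is_lipschitz_in (R : realType) (M N : metricType R) (A : set M)
    (f : M -> N) :=
  exists k, lipschitz_in k A f.

Definition contractive_in (R : realType) (M N : metricType R) (A : set M)
    (f : M -> N) :=
  exists2 k, 0 <= k < 1 & lipschitz_in k A f.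

Definition homeomorphism_in (S T : topologicalType) (A : set S) (B : set T)
    (f : S -> T) :=
  [/\ set_bij A B f, {within A, continuous f} &
      exists g : T -> S, [/\ {homo g : y / B y >-> A y}, {in A, cancel f g},
        {in B, cancel g f} & {within B, continuous g}]].

Section fractal_interpolation.
Context {T : topologicalType} (n : nat).

Definition ifs_invariant (X : set T) (w : 'I_n -> T -> T) (B : set T) :=
  [/\ B `<=` X, B !=set0, compact B & B = \bigcup_i (w i @` B)].

Definition is_attractor (X : set T) (w : 'I_n -> T -> T) (B : set T) :=
  ifs_invariant X w B /\ forall C, ifs_invariant X w C -> C = B.

End fractal_interpolation.

(* [node_pred i] and [node_succ i] are the endpoints of the (i+1)-st piece of *)
(* the subdivision x_0 < ... < x_n: pieces are numbered from 0.               *)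
Definition node_pred (n : nat) (i : 'I_n) : 'I_n.+1 := widen_ord (leqnSn n) i.
Definition node_succ (n : nat) (i : 'I_n) : 'I_n.+1 := lift ord0 i.

Definition full_itv (R : realType) (n : nat) (x : 'I_n.+1 -> R) : set R :=
  `[x ord0, x ord_max]%classic.

Definition sub_itv (R : realType) (n : nat) (x : 'I_n.+1 -> R) (i : 'I_n) : set R :=
  `[x (node_pred i), x (node_succ i)]%classic.

Definition graph_on (S T : Type) (A : set S) (f : S -> T) : set (S * T) :=
  [set (a, f a) | a in A].

(* Functions on I = [x_0, x_n] are represented by total functions, whose     *)
(* values outside I are irrelevant.                                          *)
Definition is_fractal_interpolant (R : realType) (T : topologicalType) (n : nat)
    (x : 'I_n.+1 -> R) (y : 'I_n.+1 -> T)
    (l : 'I_n -> R -> R) (F : 'I_n -> R -> T -> T) (f : R -> T) :=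
  [/\ {within full_itv x, continuous f},
      forall i, f (x i) = y i &
      is_attractor (full_itv x `*` setT)
        (fun (i : 'I_n) (p : R * T) => (l i p.1, F i p.1 p.2))
        (graph_on (full_itv x) f)].

Definition fuzzy_ifs_map (R : realType) (n : nat) (l : 'I_n -> R -> R)
    (s : 'I_n -> R) (q : 'I_n -> R -> fuzzy R) (i : 'I_n) (a : R) (z : fuzzy R) :
    fuzzy R :=
  fuzzy_add (fuzzy_scale (s i) z) (q i (l i a)).

(* As [s i >= 0], these give the endpoints of [fuzzy_ifs_map l s q i a z] at  *)
(* [lambda] when [y] is the corresponding endpoint of [z].                    *)
Definition ifs_map_lo (R : realType) (n : nat) (l : 'I_n -> R -> R)
    (s : 'I_n -> R) (q : 'I_n -> R -> fuzzy R) (lambda : R) (i : 'I_n) (a y : R) : R :=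
  s i * y + level_lo (q i (l i a)) lambda.

Definition ifs_map_hi (R : realType) (n : nat) (l : 'I_n -> R -> R)
    (s : 'I_n -> R) (q : 'I_n -> R -> fuzzy R) (lambda : R) (i : 'I_n) (a y : R) : R :=
  s i * y + level_hi (q i (l i a)) lambda.

(* Main.v *)
Require Import Defs.
From HB Require Import structures.
From mathcomp Require Import all_boot all_order all_algebra.
From mathcomp Require Import all_classical all_reals all_analysis.

Set Implicit Arguments.
Unset Strict Implicit.
Unset Printing Implicit Defensive.

Import Order.TTheory GRing.Theory Num.Theory.
Import numFieldNormedType.Exports.

Local Open Scope classical_set_scope.
Local Open Scope ring_scope.


(** The graph of [f] is invariant under the system exactly when the pieces
    [l i @` I] cover [I] and [f] satisfies the functional equation
    [f (l i a) = F i a (f a)] ([graph_on_invariantP]).  For a fixed level, the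
    left endpoint [u |-> level_lo u lambda] is 1-Lipschitz for the metric of
    fuzzy numbers, and it turns [s i . z (+) q i (l i a)] into
    [s i * level_lo z lambda + level_lo (q i (l i a)) lambda], because [s i] is
    nonnegative and nonnegative scaling does not exchange endpoints.  Applying it
    to the functional equation of [f] yields a continuous real function
    satisfying the functional equation of the real system, with the right values
    at the nodes; its graph is therefore compact and invariant.  The same holds
    for right endpoints.

    It remains to see that this graph is the only nonempty compact invariant set
    [C] over [I] ([graph_on_attractor]).  Let [K < 1] bound the contraction ratios
    of the [l i] and the factors [s i].  Each point of [C] is the image of another
    point of [C] whose vertical distance to the graph is at least [1/K] times as
    large, and these distances are bounded, so they vanish: [C] lies in the graph.
    Likewise, if a point of [I] were at positive distance from the projection of
    [C], going backwards through the [l i] would give points of [I] at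
    arbitrarily large distance from it, although [I] is bounded; so [C] projects
    onto [I], and [C] is the whole graph. *)

Section endpoints.
Context {R : realType}.
Implicit Types (u v : fuzzy R) (lambda : R).

(** Nonnegativity of [c] keeps the endpoints in order; a negative factor would
    mix [level_lo] and [level_hi]. *)
Lemma level_fuzzy_addZ c u v lambda : 0 <= c -> 0 <= lambda <= 1 ->
  level (fuzzy_add (fuzzy_scale c u) v) lambda =
  `[c * level_lo u lambda + level_lo v lambda,
    c * level_hi u lambda + level_hi v lambda]%classic.
Proof.
move=> c0 l01; rewrite level_fuzzy_add// level_fuzzy_scale// !level_itv//.
rewrite minkowski_scale_itv_ge0 ?level_lohi// minkowski_sum_itv ?level_lohi//.
by rewrite ler_wpM2l ?level_lohi.
Qed.

Lemma level_lo_addZ c u v lambda : 0 <= c -> 0 <= lambda <= 1 ->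
  level_lo (fuzzy_add (fuzzy_scale c u) v) lambda =
  c * level_lo u lambda + level_lo v lambda.
Proof.
move=> c0 l01; rewrite {1}/level_lo level_fuzzy_addZ// inf_itvcc//.
by rewrite lerD ?ler_wpM2l ?level_lohi.
Qed.

Lemma level_hi_addZ c u v lambda : 0 <= c -> 0 <= lambda <= 1 ->
  level_hi (fuzzy_add (fuzzy_scale c u) v) lambda =
  c * level_hi u lambda + level_hi v lambda.
Proof.
move=> c0 l01; rewrite {1}/level_hi level_fuzzy_addZ// sup_itvcc//.
by rewrite lerD ?ler_wpM2l ?level_lohi.
Qed.

Lemma short_map_continuous (M : metricType R) (h : M -> R) :
  (forall a b, `|h a - h b| <= mdist a b) -> continuous h.
Proof.
move=> hM a; apply/cvgrPdist_lt => e e0.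
apply/nbhs_ballP; exists e => //= b; rewrite ballEmdist/= => ab.
exact: le_lt_trans (hM a b) ab.
Qed.

Lemma level_lo_continuous lambda : 0 <= lambda <= 1 ->
  continuous (fun u => level_lo u lambda).
Proof.
move=> l01; apply: short_map_continuous => u v.
by apply: le_trans (gap_le_dist u v l01); rewrite le_max lexx.
Qed.

Lemma level_hi_continuous lambda : 0 <= lambda <= 1 ->
  continuous (fun u => level_hi u lambda).
Proof.
move=> l01; apply: short_map_continuous => u v.
by apply: le_trans (gap_le_dist u v l01); rewrite le_max lexx orbT.
Qed.

End endpoints.


(** This extracts from the attractor property everything that is used about
    [f]: projecting the invariant graph to [A] gives the covering by the images
    [l i @` A], and reading it fiberwise gives the functional equation. *)
Lemma graph_on_invariantP (S T : Type) (n : nat) (A : set S) (l : 'I_n -> S -> S)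
    (F : 'I_n -> S -> T -> T) (f : S -> T) :
  graph_on A f = \bigcup_i ((fun p => (l i p.1, F i p.1 p.2)) @` graph_on A f) <->
  A = \bigcup_i (l i @` A) /\ forall i a, A a -> f (l i a) = F i a (f a).
Proof.
split=> [Gw|[Al fl]].
  have wG i a : A a -> A (l i a) /\ f (l i a) = F i a (f a).
    move=> Aa; have : graph_on A f (l i a, F i a (f a)).
      by rewrite Gw; exists i => //; exists (a, f a) => //; exists a.
    by move=> [b Ab [<- ->]].
  split=> [|i a Aa]; last by have [] := wG i a Aa.
  apply/seteqP; split=> [b Ab|_ [i _ [a Aa <-]]]; last by have [] := wG i a Aa.
  have : graph_on A f (b, f b) by exists b.
  by rewrite Gw => -[i _ [_ [a Aa <-] [<- _]]]; exists i => //; exists a.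
apply/seteqP; split=> [_ [b + <-]|_ [i _ [_ [a Aa <-] <-]]] /=.
  rewrite {1}Al => -[i _ [a Aa <-]]; exists i => //; exists (a, f a); first by exists a.
  by rewrite fl.
by exists (l i a); [rewrite Al; exists i => //; exists a|rewrite fl].
Qed.

Lemma compact_graph_on (S T : topologicalType) (A : set S) (f : S -> T) :
  {within A, continuous f} -> compact A -> compact (graph_on A f).
Proof.
move=> /subspace_continuousP cf; apply: continuous_compact.
apply/subspace_continuousP => a Aa; apply: cvg_pair; last exact: cf.
exact: cvg_within.
Qed.

Section contraction.
Context {R : realType}.

(** The common ratio is taken positive, so that one can divide by it. *)
Lemma uniform_ratio n (k : 'I_n -> R) : (forall i, k i < 1) ->
  exists2 K, 0 < K < 1 & forall i, k i <= K.
Proof.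
move=> k1; exists (\big[Num.max/2^-1]_i k i); last first.
  by move=> i; apply: le_bigmax.
apply/andP; split; first by apply: lt_le_trans (bigmax_ge_id _ _ _ _).
by apply: bigmax_lt => //; rewrite invf_lt1// ltr1n.
Qed.

(** The supremum [S] of [A] satisfies [S <= k * S] with [k < 1].  This replaces
    the iteration [t <= k ^+ N * M] in contraction arguments. *)
Lemma le0_of_expanding (k : R) (A : set R) : 0 <= k < 1 -> has_ubound A ->
  (forall t, A t -> exists2 t', A t' & t <= k * t') -> forall t, A t -> t <= 0.
Proof.
move=> /andP[k0 k1] ubA Ak t At.
have A_sup r : A r -> r <= sup A by move=> Ar; exact: ub_le_sup.
have supk : sup A <= k * sup A.
  apply: ge_sup; first by exists t.
  move=> r /Ak[r' Ar' /le_trans]; apply.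
  by rewrite ler_wpM2l// A_sup.
apply: (le_trans (A_sup _ At)).
rewrite -(@pmulr_rle0 _ (1 - k)) ?subr_gt0//.
by rewrite mulrBl mul1r subr_le0.
Qed.

(** The uniqueness half of the attractor property of [A] for the maps [l i]
    alone: a lower bound [t] for the distance from [l i a] to [K] gives the lower
    bound [k^-1 * t] for the distance from [a] to [K], as [l i] maps [K] into
    itself and contracts by [k].  Lower bounds are used instead of the distance to
    [K] itself. *)
Lemma contractive_cover_sub n (k : R) (A K : set R) (l : 'I_n -> R -> R) :
  0 < k < 1 -> bounded_set A -> A `<=` \bigcup_i (l i @` A) ->
  (forall i, lipschitz_in k A (l i)) ->
  closed K -> K !=set0 -> K `<=` A -> (forall i, l i @` K `<=` K) ->
  A `<=` K.
Proof.
move=> /andP[k0 k1] [M [_ /(_ (M + 1))]].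
rewrite ltrDl ltr01 => /(_ isT) AM Al lk Kc [c0 Kc0] KA lK.
pose D := [set t | exists2 b, A b & forall c, K c -> t <= `|b - c|].
have D_le0 : forall t, D t -> t <= 0.
  apply: (@le0_of_expanding k); first by rewrite ltW.
    exists ((M + 1) + (M + 1)) => t [b Ab /(_ _ Kc0) /le_trans]; apply.
    by rewrite (le_trans (ler_normB _ _))// lerD// AM//; exact: KA.
  move=> t [b /Al[i _ [a Aa <-]] tD]; exists (k^-1 * t); last first.
    by rewrite mulrA divff ?mul1r// gt_eqF.
  exists a => // c Kc'; rewrite ler_pdivrMl//.
  apply: (le_trans (tD (l i c) _)); first by apply: (lK i); exists c.
  by rewrite distrC (distrC a); exact: lk (KA _ Kc').
move=> b Ab; apply: Kc => V /nbhs_ballP[e /= e0 Ve].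
apply: contrapT => KV.
suff /D_le0 : D e by rewrite leNgt e0.
exists b => // c Kc'; rewrite leNgt; apply/negP => bce.
by apply: KV; exists c; split=> //; apply: Ve.
Qed.

(** Two separate contractions are at work: that of the [F i a] forces any
    invariant set into the graph of [g], and that of the [l i] forces its
    projection to fill [A]. *)
Lemma graph_on_attractor n (k : R) (A : set R) (l : 'I_n -> R -> R)
    (F : 'I_n -> R -> R -> R) (g : R -> R) :
  0 < k < 1 -> compact A -> A !=set0 -> A = \bigcup_i (l i @` A) ->
  (forall i, lipschitz_in k A (l i)) ->
  (forall i a y z, A a -> `|F i a y - F i a z| <= k * `|y - z|) ->
  {within A, continuous g} -> (forall i a, A a -> g (l i a) = F i a (g a)) ->
  is_attractor (A `*` setT) (fun i (p : R * R) => (l i p.1, F i p.1 p.2))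
    (graph_on A g).
Proof.
move=> k01 Ac [a0 Aa0] Al lk Fk cg gl; have /andP[k0 k1] := k01.
split.
  split; [by move=> _ [a Aa <-]|by exists (a0, g a0); exists a0| |].
    exact: compact_graph_on.
  exact/graph_on_invariantP.
move=> C [CA [p0 Cp0] Cc Cw].
have C1 : compact (fst @` C).
  by apply: continuous_compact Cc; apply: continuous_subspaceT => p; exact: cvg_fst.
have C2 : compact (snd @` C).
  by apply: continuous_compact Cc; apply: continuous_subspaceT => p; exact: cvg_snd.
(* C lies in the graph: the vertical gaps |y - g a| over C form an expanding set *)
have Cg p : C p -> p.2 = g p.1.
  have [M [_ /(_ (M + 1))]] := compact_bounded C2.
  rewrite ltrDl ltr01 => /(_ isT) CM.
  have [N [_ /(_ (N + 1))]] := compact_bounded (continuous_compact cg Ac).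
  rewrite ltrDl ltr01 => /(_ isT) gN.
  move=> Cp; apply/eqP; rewrite -subr_eq0 -normr_le0.
  apply: (@le0_of_expanding k [set `|p.2 - g p.1| | p in C]); last by exists p.
  - by rewrite ltW.
  - exists ((M + 1) + (N + 1)) => _ [[a y] Cay <-] /=.
    have [Aa _] := CA _ Cay.
    rewrite (le_trans (ler_normB _ _))// lerD//.
      by apply: CM; exists (a, y).
    by apply: gN; exists a.
  - move=> _ [q + <-]; rewrite {1}Cw => -[i _ [[a y] Cay <-]] /=.
    have [/= Aa _] := CA _ Cay.
    by exists `|y - g a|; [exists (a, y)|rewrite gl// Fk].
have AC : A `<=` fst @` C.
  apply: (contractive_cover_sub k01 (compact_bounded Ac) _ lk).
  - by rewrite -Al.
  - by apply: compact_closed C1; exact: Rhausdorff.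
  - by exists p0.1; exists p0.
  - by move=> _ [p /CA[Ap _] <-].
  - move=> i _ [_ [[a y] Cay <-] <-]; exists (l i a, F i a y) => //.
    by rewrite Cw; exists i => //; exists (a, y).
apply/seteqP; split=> [p Cp|_ [a /AC[p Cp <-] <-]].
  by have [Ap _] := CA _ Cp; exists p.1 => //; rewrite -Cg//; case: p {Cp Ap}.
by rewrite -Cg//; case: p Cp.
Qed.

End contraction.

(** An observable [e] which conjugates the maps [F i a] to affine maps with slopes
    in [[0, 1)] sends fractal interpolants to fractal interpolants; it is applied
    to both endpoints of a level. *)
Lemma fractal_interpolant_comp (R : realType) (T : topologicalType) n
    (x : 'I_n.+1 -> R) (u : 'I_n.+1 -> T)
    (l : 'I_n -> R -> R) (s : 'I_n -> R) (F : 'I_n -> R -> T -> T) (c : 'I_n -> R -> R)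
    (f : R -> T) (e : T -> R) :
  (forall i, contractive_in (full_itv x) (l i)) -> (forall i, 0 <= s i < 1) ->
  continuous e -> (forall i a z, e (F i a z) = s i * e z + c i a) ->
  is_fractal_interpolant x u l F f ->
  is_fractal_interpolant x (e \o u) l (fun i a y => s i * y + c i a) (e \o f).
Proof.
move=> lctr s01 ce eF [cf fx [[_ [[_ _] [a0 Aa0 _]] _ Gw] _]].
have [Al fl] := (graph_on_invariantP _ _ _ _).1 Gw.
have [r r01 lr] : exists2 r : 'I_n -> R, (forall i, 0 <= r i < 1) &
    forall i, lipschitz_in (r i) (full_itv x) (l i).
  by exists (fun i => s2val (cid2 (lctr i))) => i; case: cid2.
have [K K01 rsK] : exists2 K, 0 < K < 1 & forall i, Num.max (r i) (s i) <= K.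
  apply: uniform_ratio => i; rewrite gt_max.
  by have /andP[_ ->] := r01 i; have /andP[_ ->] := s01 i.
have cef : {within full_itv x, continuous (e \o f)}.
  by apply: within_continuous_comp cf => z _; exact: ce.
split=> [//|i /=|]; first by rewrite fx.
apply: (@graph_on_attractor _ n K (full_itv x) l (fun i a y => s i * y + c i a)
  (e \o f)) => //.
- exact: segment_compact.
- by exists a0.
- move=> i a b Aa Ab; apply: (le_trans (lr i a b Aa Ab)).
  apply: ler_wpM2r; first exact: mdist_ge0.
  by apply: le_trans (rsK i); rewrite le_max lexx.
- move=> i a y z _; rewrite opprD addrACA subrr addr0 -mulrBr normrM.
  rewrite ler_wpM2r// ger0_norm; last by have /andP[] := s01 i.
  by apply: le_trans (rsK i); rewrite le_max lexx orbT.
- by move=> i a Aa /=; rewrite fl.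
Qed.

Theorem theorem4 (R : realType) (n : nat) (n_gt0 : (0 < n)%N)
    (x : 'I_n.+1 -> R) (u : 'I_n.+1 -> fuzzy R)
    (l : 'I_n -> R -> R) (s : 'I_n -> R) (q : 'I_n -> R -> fuzzy R)
    (f : R -> fuzzy R)
    (x_incr : forall i : 'I_n, x (node_pred i) < x (node_succ i))
    (l_homeo : forall i, homeomorphism_in (full_itv x) (sub_itv x i) (l i))
    (l_contr : forall i, contractive_in (full_itv x) (l i))
    (l_first : forall i, l i (x ord0) = x (node_pred i))
    (l_last : forall i, l i (x ord_max) = x (node_succ i))
    (s_bound : forall i, 0 <= s i < 1)
    (q_lip : forall i, is_lipschitz_in (sub_itv x i) (q i))
    (F_first : forall i,
       fuzzy_ifs_map l s q i (x ord0) (u ord0) = u (node_pred i))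
    (F_last : forall i,
       fuzzy_ifs_map l s q i (x ord_max) (u ord_max) = u (node_succ i))
    (f_fif : is_fractal_interpolant x u l (fuzzy_ifs_map l s q) f) :
  forall lambda : R, 0 <= lambda <= 1 ->
    is_fractal_interpolant x (fun i => level_lo (u i) lambda) l
      (ifs_map_lo l s q lambda) (fun a => level_lo (f a) lambda) /\
    is_fractal_interpolant x (fun i => level_hi (u i) lambda) l
      (ifs_map_hi l s q lambda) (fun a => level_hi (f a) lambda).
Proof.
move=> lambda l01; split.
- apply: (fractal_interpolant_comp l_contr s_bound (level_lo_continuous l01) _ f_fif).
  by move=> i a z; apply: level_lo_addZ => //; have /andP[] := s_bound i.
- apply: (fractal_interpolant_comp l_contr s_bound (level_hi_continuous l01) _ f_fif).
  by move=> i a z; apply: level_hi_addZ => //; have /andP[] := s_bound i.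
Qed.
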